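(* Let $R_1,R_2,R_3$ be independent (standard) Rayleigh random variables, so that three independent points at distances $R_1,R_2,R_3$ from the origin with independent uniform directions are independent standard bivariate normals. Then $$\mathbb{E}\left[P_{\text{obt}}(R_1,R_2,R_3)\right]=\frac34.$$
   Context: A standard Rayleigh variable $R$ is the Euclidean norm of a standard bivariate normal vector (so $R^2/2$ is exponential with mean $1$). For $r_1,r_2,r_3\ge0$ with at most one of them equal to zero, $P_{\text{obt}}(r_1,r_2,r_3)$ denotes the probability that the triangle $Q_1Q_2Q_3$ is obtuse (non-degenerate with some interior angle exceeding $\pi/2$), where $Q_1,Q_2,Q_3$ are independent and $Q_k$ is uniform on the circle of radius $r_k$ about the origin of $\mathbb{R}^2$. Equivalently, $P_{\text{obt}}(r_1,r_2,r_3)=\frac12\sum_{k=1}^3\Pr(r_i^2\sin^2X+r_j^2\sin^2Y>r_k^2)$, where $X,Y$ are independent and uniform on $(0,\pi/2)$ and, in each summand, $\{i,j,k\}=\{1,2,3\}$. *)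

(* Defs.v *)
From HB Require Import structures.
From mathcomp Require Import all_boot all_order all_algebra.
From mathcomp Require Import all_classical all_reals all_analysis.

Set Implicit Arguments.
Unset Strict Implicit.
Unset Printing Implicit Defensive.

Import Order.TTheory GRing.Theory Num.Theory.
Import numFieldNormedType.Exports.

Local Open Scope classical_set_scope.
Local Open Scope ring_scope.

(* The library norm on [R * R] is the sup norm, hence an explicit Euclidean
   structure. *)
Definition dot2 (R : realType) (u v : R * R) : R := u.1 * v.1 + u.2 * v.2.

Definition enorm2 (R : realType) (u : R * R) : R := Num.sqrt (dot2 u u).

Definition det2 (R : realType) (u v : R * R) : R := u.1 * v.2 - u.2 * v.1.

(* Meaningful for [A <> V] and [B <> V] only. *)
Definition angle_at (R : realType) (V A B : R * R) : R :=
  acos (dot2 (A - V) (B - V) / (enorm2 (A - V) * enorm2 (B - V))).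

Definition nondegenerate_triangle (R : realType) (A B C : R * R) : Prop :=
  det2 (B - A) (C - A) != 0.

Definition obtuse_triangle (R : realType) (A B C : R * R) : Prop :=
  nondegenerate_triangle A B C /\
  [\/ pi / 2 < angle_at A B C, pi / 2 < angle_at B C A
    | pi / 2 < angle_at C A B].

Definition circle_point (R : realType) (r t : R) : R * R :=
  (r * cos t, r * sin t).

Lemma twopi_gt0 (R : realType) : 0 < 2 * pi :> R.
Proof. by rewrite mulr_gt0// pi_gt0. Qed.

Definition unif_angle (R : realType) : probability (measurableTypeR R) R :=
  uniform_prob (twopi_gt0 R).

Definition P_obt (R : realType) (r1 r2 r3 : R) : R :=
  fine (((unif_angle R \x unif_angle R) \x unif_angle R)%E
    [set t | obtuse_triangle (circle_point r1 t.1.1)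
                             (circle_point r2 t.1.2)
                             (circle_point r3 t.2)]).

Definition std_normal (R : realType) : probability (measurableTypeR R) R :=
  normal_prob (0 : R) 1.

Definition std_normal2 (R : realType) : set (R * R) -> \bar R :=
  (std_normal R \x std_normal R)%E.

Definition is_rayleigh d (T : measurableType d) (R : realType)
    (P : probability T R) (X : {RV P >-> R}) : Prop :=
  forall A : set R, measurable A ->
    distribution P X A = pushforward (@std_normal2 R) (@enorm2 R) A.

Definition mutually_independent d d' (T : measurableType d)
    (T' : measurableType d') (R : realType) (P : probability T R)
    (I : finType) (X : I -> {RV P >-> T'}) : Prop :=
  forall (J : {set I}) (B : I -> set T'), (forall i, measurable (B i)) ->
    P (\bigcap_(i in [set` J]) (X i @^-1` B i)) =
    (\prod_(i in J) P (X i @^-1` B i))%E.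

(* Main.v *)
Require Import Defs.
From mathcomp Require Import all_boot all_order all_algebra.
From mathcomp Require Import all_classical all_reals all_analysis.
From HB Require Import structures.
From mathcomp Require Import measurable_realfun ring lra.

Set Implicit Arguments.
Unset Strict Implicit.
Unset Printing Implicit Defensive.

Import Order.TTheory GRing.Theory Num.Theory.
Import numFieldNormedType.Exports.

Local Open Scope classical_set_scope.
Local Open Scope ring_scope.

(** Three points at independent Rayleigh distances from the origin, in
    independent uniform directions, are three independent standard bivariate
    normal points A, B, C; so the claim is that these form an obtuse triangle
    with probability 3/4.

    The polar decomposition of the bivariate normal law ([std_normal2_polar])
    is obtained without polar coordinates.  The product of two standard normal
    laws is invariant under rotations ([ge0_integral_std_normal2_rot]), because
    its density is radial and because a rotation is a product of three shears,
    which preserve the area by translation invariance and Fubini.  Hence a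
    normal point may be rotated by an independent uniform angle; its direction
    is then uniform, independently of its norm.

    Being obtuse at a vertex means that a dot product is negative.  At most one
    of the three angles is obtuse ([obtuse_at_le1]) and collinear points have
    probability 0 ([std_normal2_degenerate]), so the probability is three times
    that of (A - V).(B - V) < 0 for independent standard normals A, B, V.  Now
    (A - V).(B - V) = |M - V|^2 - |A - B|^2 / 4, where M is the midpoint of A
    and B.  Rotating A against B, and then A + B against V, turns A - B and
    M - V into independent standard normals h and g, up to scalar factors, and
    the event into 3 |g|^2 < |h|^2 ([std_normal2_obtuse_at]).

    Finally |h|^2 is exponential with mean 2 ([std_normal2_tail]), so this event
    has probability E exp (- 3 |g|^2 / 2).  The last expectation factors over
    the two coordinates of g, each factor being 1/2 by rescaling the Gaussian
    integral; the event has probability 1/4 ([std_normal2_ratio]). *)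

(** * Change of variables and change of density *)

(** Change of variables, for a measure only known to agree with the image
    measure on measurable sets. *)
Lemma ge0_integral_image d d' (T : measurableType d) (T' : measurableType d')
    (R : realType) (m : {measure set T -> \bar R}) (m' : {measure set T' -> \bar R})
    (g : T -> T') : measurable_fun [set: T] g ->
    (forall A, measurable A -> m' A = m (g @^-1` A)) ->
  forall f : T' -> \bar R, measurable_fun [set: T'] f -> (forall x, 0 <= f x)%E ->
  (\int[m']_x f x = \int[m]_x f (g x))%E.
Proof.
move=> mg m'E f mf f0.
have := @ge0_integral_pushforward _ _ _ _ R g mg m setT f measurableT mf (fun x _ => f0 x).
rewrite preimage_setT => <-.
by apply: eq_measure_integral => A mA _; exact: m'E.
Qed.

Section lebesgue_substitution.
Context {R : realType}.
Local Notation mu := (@lebesgue_measure R).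
Implicit Type f : R -> \bar R.

Lemma measurable_affine (a b : R) : measurable_fun [set: R] (fun x : R => a * x + b).
Proof. by apply: measurable_funD => //; exact: measurable_funM. Qed.

Lemma ge0_integral_lebesgueN f :
  measurable_fun [set: R] f -> (forall x, 0 <= f x)%E ->
  (\int[mu]_x f (- x)%R = \int[mu]_x f x)%E.
Proof.
move=> mf f0.
have -> : (\int[mu]_x f x = \int[pushforward mu (-%R : _ -> measurableTypeR R)]_x f x)%E.
  by apply: eq_measure_integral => //= A mA _; exact/esym/lebesgue_measureN.
by rewrite ge0_integral_pushforward.
Qed.

Lemma lebesgue_measure_affine (a b : R) (A : set R) : 0 < a -> measurable A ->
  mu A = (a%:E * pushforward mu (fun x : R => (a * x + b)%R : measurableTypeR R) A)%E.
Proof.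
move=> a0 mA.
pose k : {nonneg R} := NngNum (ltW a0).
pose g : R -> measurableTypeR R := fun x => a * x + b.
have mg : measurable_fun [set: measurableTypeR R] g by exact: measurable_affine.
rewrite (@lebesgue_measure_unique _ (mscale k (pushforward mu g)))//= => _ [[c d]] _ <-.
rewrite /mscale/= lebesgue_measure_itv/= lte_fin /pushforward.
rewrite (_ : g @^-1` _ = `]((c - b) / a), ((d - b) / a)]%classic); last first.
  apply/seteqP; split => x /=; rewrite !in_itv/= /g ltr_pdivrMr// ler_pdivlMr//;
  by rewrite ltrBlDr lerBrDr mulrC.
rewrite lebesgue_measure_itv/= lte_fin ltr_pM2r ?invr_gt0// ltrD2r.
case: ifPn => _; last by rewrite mule0.
rewrite -!EFinD -EFinM; congr EFin.
by field; rewrite gt_eqF.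
Qed.

Lemma ge0_integral_lebesgue_affine f (a b : R) : a != 0 ->
  measurable_fun [set: R] f -> (forall x, 0 <= f x)%E ->
  (`|a|%:E * \int[mu]_x f (a * x + b)%R = \int[mu]_x f x)%E.
Proof.
wlog a0 : a f / 0 < a => [hw a0 mf f0|_].
  have [a_lt0|a_gt0] := ltP a 0; last by apply: hw; rewrite // lt_def a0.
  rewrite -(hw (- a) f) ?oppr_gt0 ?oppr_eq0// normrN; congr (_ * _)%E.
  rewrite -[RHS]ge0_integral_lebesgueN//.
    by apply: eq_integral => x _; rewrite mulrNN.
  by apply: measurableT_comp => //; exact: measurable_affine.
move=> mf f0; rewrite gtr0_norm//.
pose k : {nonneg R} := NngNum (ltW a0).
rewrite [RHS](@ge0_integral_image _ _ _ _ R (mscale k mu) mu _ (measurable_affine a b))//.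
  rewrite ge0_integral_mscale//.
  by apply: measurableT_comp => //; exact: measurable_affine.
by move=> A mA; exact: lebesgue_measure_affine.
Qed.

Lemma ge0_integral_lebesgue_shift f (b : R) :
  measurable_fun [set: R] f -> (forall x, 0 <= f x)%E ->
  (\int[mu]_x f (x + b)%R = \int[mu]_x f x)%E.
Proof.
move=> mf f0; rewrite -(@ge0_integral_lebesgue_affine f 1 b)// normr1 mul1e.
by apply: eq_integral => x _; rewrite mul1r.
Qed.

End lebesgue_substitution.

(** Integration against a measure nu with density h with respect to m. *)
Section density.
Local Open Scope ereal_scope.
Context d (T : measurableType d) (R : realType).
Variables (m nu : {measure set T -> \bar R}) (h : T -> R).
Hypothesis mh : measurable_fun [set: T] h.
Hypothesis h0 : forall x, (0 <= h x)%R.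
Hypothesis nuE : forall A, measurable A -> nu A = \int[m]_(x in A) (h x)%:E.

Import HBNNSimple.

Let density_indic (E : set T) : measurable E ->
  \int[nu]_x (\1_E x)%:E = \int[m]_x ((h x)%:E * (\1_E x)%:E).
Proof.
move=> mE; rewrite integral_indic// setIT nuE// [LHS]integral_mkcond.
apply: eq_integral => x _; rewrite patchE indicE.
by case: ifPn => _; rewrite ?mule1 ?mule0.
Qed.

Let density_nnsfun (f : {nnsfun T >-> R}) :
  \int[nu]_x (f x)%:E = \int[m]_x ((h x)%:E * (f x)%:E).
Proof.
under [LHS]eq_integral do rewrite fimfunE -fsumEFin//.
rewrite [LHS]ge0_integral_fsum//; last 2 first.
  - by move=> r; exact/measurable_EFinP/measurableT_comp.
  - by move=> n x _; rewrite EFinM nnfun_muleindic_ge0.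
under [RHS]eq_integral.
  move=> x xD; rewrite fimfunE -fsumEFin// ge0_mule_fsumr; last first.
    by move=> r; rewrite EFinM nnfun_muleindic_ge0.
  over.
rewrite [RHS]ge0_integral_fsum//; last 2 first.
  - move=> r; apply: emeasurable_funM; first exact/measurable_EFinP.
    by apply/measurable_EFinP; apply/measurableT_comp => //.
  - move=> n x _; rewrite EFinM mule_ge0//; last by rewrite nnfun_muleindic_ge0.
    by rewrite lee_fin.
apply: eq_fsbigr => r rf; have r0 : (0 <= r)%R.
  by move: rf; rewrite inE/= => -[x _ <-].
under eq_integral do rewrite EFinM.
under [RHS]eq_integral do rewrite EFinM muleCA.
rewrite !ge0_integralZl// ?density_indic//.
- apply: emeasurable_funM; first exact/measurable_EFinP.
  exact/measurable_EFinP.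
- by move=> x _; rewrite mule_ge0 ?lee_fin.
- exact/measurable_EFinP.
Qed.

Lemma ge0_integral_density (f : T -> \bar R) :
  measurable_fun setT f -> (forall x, 0 <= f x) ->
  \int[nu]_x f x = \int[m]_x ((h x)%:E * f x).
Proof.
move=> mf f0.
pose f_ := nnsfun_approx measurableT mf.
transitivity (lim (\int[nu]_x (f_ n x)%:E @[n --> \oo])).
  rewrite -monotone_convergence//=.
  - apply: eq_integral => ? /[!inE] xD; apply/esym/cvg_lim => //=.
    exact: cvg_nnsfun_approx.
  - by move=> n; exact/measurable_EFinP/measurable_funTS.
  - by move=> n ? _; rewrite lee_fin.
  - by move=> ? _ ? ? mn; rewrite lee_fin; exact/lefP/nd_nnsfun_approx.
transitivity (lim (\int[m]_x ((h x)%:E * (f_ n x)%:E) @[n --> \oo])).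
  by apply: congr_lim; apply/funext => n /=; exact: density_nnsfun.
rewrite -monotone_convergence//=.
- apply: eq_integral => x _; apply/cvg_lim => //=.
  by apply: cvgeZl => //; exact: cvg_nnsfun_approx.
- by move=> n; apply: emeasurable_funM; exact/measurable_EFinP.
- by move=> n x _; rewrite mule_ge0 ?lee_fin.
- move=> x _ p q pq; apply: lee_wpmul2l; rewrite ?lee_fin//.
  exact/lefP/nd_nnsfun_approx.
Qed.

End density.

(** * Products of probability measures *)

Section probability_product.
Local Open Scope ereal_scope.
Context d d' (T : measurableType d) (T' : measurableType d') (R : realType).

(** The product of two probability measures, as a probability measure. *)
Definition prodp (P : probability T R) (Q : probability T' R) : set (T * T') -> \bar R :=
  P \x Q.

Variables (P : probability T R) (Q : probability T' R).

HB.instance Definition _ := Measure.copy (prodp P Q) (P \x Q).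

Let prodp_setT : prodp P Q [set: T * T'] = 1.
Proof.
rewrite /prodp -setXTT product_measure1E//.
transitivity (P setT * Q setT) => //.
by rewrite (probability_setT P) (probability_setT Q) mule1.
Qed.

HB.instance Definition _ := Measure_isProbability.Build _ _ _ (prodp P Q) prodp_setT.

Lemma integral_prob_cst (c : \bar R) : \int[P]_x c = c.
Proof.
have -> : (fun=> c) = cst c :> (T -> \bar R) by [].
rewrite integral_cst//; transitivity (c * 1); last by rewrite mule1.
by congr (_ * _); exact: probability_setT.
Qed.

Lemma integral_prodp (f : T * T' -> \bar R) :
  measurable_fun [set: T * T'] f -> (forall z, 0 <= f z) ->
  \int[prodp P Q]_z f z = \int[P]_x \int[Q]_y f (x, y).
Proof. by move=> mf f0; exact: (@fubini_tonelli1 _ _ _ _ _ P Q f mf f0). Qed.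

Lemma integral_prob_swap (f : T * T' -> \bar R) :
  measurable_fun [set: T * T'] f -> (forall z, 0 <= f z) ->
  \int[P]_x \int[Q]_y f (x, y) = \int[Q]_y \int[P]_x f (x, y).
Proof. by move=> mf f0; exact: (@fubini_tonelli _ _ _ _ _ P Q f mf f0). Qed.

Lemma measurable_integral_snd (f : T * T' -> \bar R) :
  measurable_fun [set: T * T'] f -> (forall z, 0 <= f z) ->
  measurable_fun [set: T] (fun x => \int[Q]_y f (x, y)).
Proof. exact: (@measurable_fun_fubini_tonelli_F _ _ _ _ _ Q). Qed.

Lemma measurable_integral_fst (f : T * T' -> \bar R) :
  measurable_fun [set: T * T'] f -> (forall z, 0 <= f z) ->
  measurable_fun [set: T'] (fun y => \int[P]_x f (x, y)).
Proof. exact: (@measurable_fun_fubini_tonelli_G _ _ _ _ _ P). Qed.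

End probability_product.

(** * Rotation invariance of the standard bivariate normal law *)

(** Measurability of real expressions built from projections and constants. *)
Ltac solve_measurable := repeat first
  [ exact: measurable_cst | exact: measurable_id | exact: measurable_fst
  | exact: measurable_snd | assumption
  | apply: measurable_fun_pair | apply: measurable_funB | apply: measurable_funD
  | apply: measurable_funM | apply: measurable_funX | apply: measurable_funN
  | apply: (measurableT_comp measurable_fst) | apply: (measurableT_comp measurable_snd)
  | apply: (measurableT_comp (@measurable_expR _)) ].

Section rotation.
Context {R : realType}.
Local Notation mu := (@lebesgue_measure R).
Local Notation N := (std_normal R).
Local Notation N2 := (prodp N N).
Implicit Type f : R * R -> \bar R.

Let iint f := (\int[mu]_x \int[mu]_y f (x, y))%E.

(** The rotation of the plane with cosine c and sine s; nothing is assumed on c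
    and s, lemmas require c ^+ 2 + s ^+ 2 = 1. *)
Definition rot2 (c s : R) (z : R * R) : R * R := (c * z.1 - s * z.2, s * z.1 + c * z.2).

Lemma measurable_rot2 c s : measurable_fun [set: R * R] (rot2 c s).
Proof. by rewrite /rot2; solve_measurable. Qed.

Let iint_shearl f (a : R) : measurable_fun [set: R * R] f -> (forall z, 0 <= f z)%E ->
  iint (fun z => f (z.1 + a * z.2, z.2)) = iint f.
Proof.
move=> mf f0; rewrite /iint.
have mg : measurable_fun [set: R * R] (fun z => f (z.1 + a * z.2, z.2)).
  by apply: measurableT_comp => //; solve_measurable.
transitivity (\int[mu]_y \int[mu]_x f ((x + a * y)%R, y))%E.
  have h := @fubini_tonelli _ _ _ _ _ mu mu (fun z => f (z.1 + a * z.2, z.2)) mg (fun z => f0 _).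
  exact h.
transitivity (\int[mu]_y \int[mu]_x f (x, y))%E; last first.
  by have h := @fubini_tonelli _ _ _ _ _ mu mu f mf f0; rewrite h.
apply: eq_integral => y _ /=.
rewrite (@ge0_integral_lebesgue_shift _ (fun x => f (x, y)))//.
exact: measurable_fun_pair1.
Qed.

Let iint_shearr f (a : R) : measurable_fun [set: R * R] f -> (forall z, 0 <= f z)%E ->
  iint (fun z => f (z.1, z.2 + a * z.1)) = iint f.
Proof.
move=> mf f0; rewrite /iint.
apply: eq_integral => x _ /=.
rewrite (@ge0_integral_lebesgue_shift _ (fun y => f (x, y)))//.
exact: measurable_fun_pair2.
Qed.

(* A rotation other than the half turn is a horizontal shear, a vertical shear
   and the first shear again; t is minus the tangent of the half angle. *)
Let iint_rot2 f (c s : R) : c ^+ 2 + s ^+ 2 = 1 -> c != -1 ->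
  measurable_fun [set: R * R] f -> (forall z, 0 <= f z)%E ->
  iint (f \o rot2 c s) = iint f.
Proof.
move=> cs c1 mf f0.
have c1' : 1 + c != 0 by rewrite addrC addr_eq0.
pose t := - (s / (1 + c)).
pose f1 (z : R * R) := f (z.1 + t * z.2, z.2).
pose f2 (z : R * R) := f1 (z.1, z.2 + s * z.1).
have mf1 : measurable_fun [set: R * R] f1.
  by apply: measurableT_comp => //; solve_measurable.
have mf2 : measurable_fun [set: R * R] f2.
  by apply: measurableT_comp => //; solve_measurable.
transitivity (iint f1); last exact: iint_shearl.
transitivity (iint f2); last exact: (iint_shearr s mf1 (fun z => f0 _)).
transitivity (iint (fun z => f2 (z.1 + t * z.2, z.2))); last first.
  exact: (iint_shearl t mf2 (fun z => f0 _)).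
congr iint; apply/funext => -[x y] /=; rewrite /f2 /f1 /rot2/=; congr f.
have ts : t * s = c - 1.
  have -> : t * s = - (s ^+ 2) / (1 + c) by rewrite /t; field.
  by have -> : s ^+ 2 = 1 - c ^+ 2; [rewrite -cs; ring|field].
have tc : t * (1 + c) = - s by rewrite /t; field.
congr pair.
  have -> : x + t * y + t * (y + s * (x + t * y)) =
    x + t * s * x + t * y * (2 + t * s) by ring.
  rewrite ts; have -> : t * y * (2 + (c - 1)) = (t * (1 + c)) * y by ring.
  by rewrite tc; ring.
have -> : y + s * (x + t * y) = s * x + (1 + t * s) * y by ring.
by rewrite ts; ring.
Qed.

Lemma normal_pdf_prodE (x y : R) : normal_pdf 0 1 x * normal_pdf 0 1 y =
  normal_peak 1 ^+ 2 * expR (- (x ^+ 2 + y ^+ 2) / 2).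
Proof.
rewrite normal_pdfE ?oner_eq0// /normal_fun !subr0 expr1n -[1 *+ 2]/(2%:R).
by rewrite mulrACA -expRD; congr (_ * expR _); lra.
Qed.

Lemma ge0_integral_std_normal (f : R -> \bar R) :
  measurable_fun [set: R] f -> (forall x, 0 <= f x)%E ->
  (\int[N]_x f x = \int[mu]_x ((normal_pdf 0 1 x)%:E * f x))%E.
Proof.
move=> mf f0; apply: ge0_integral_density => //.
- exact: measurable_normal_pdf.
- by move=> x; exact: normal_pdf_ge0.
Qed.

Lemma ge0_integral_std_normal2 f :
  measurable_fun [set: R * R] f -> (forall z, 0 <= f z)%E ->
  (\int[N2]_z f z = \int[mu]_x \int[mu]_y
     ((normal_peak 1 ^+ 2 * expR (- (x ^+ 2 + y ^+ 2) / 2))%:E * f (x, y)))%E.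
Proof.
move=> mf f0; rewrite (integral_prodp N N mf f0).
rewrite ge0_integral_std_normal//; first last.
- by move=> x; exact: integral_ge0.
- exact: (measurable_integral_snd N mf f0).
apply: eq_integral => x _.
have mfx : measurable_fun [set: R] (fun y => f (x, y)) by exact: measurable_fun_pair2.
rewrite ge0_integral_std_normal// -ge0_integralZl//.
- by apply: eq_integral => y _; rewrite muleA -EFinM normal_pdf_prodE.
- apply: emeasurable_funM => //; apply/measurable_EFinP.
  exact: measurable_normal_pdf.
- by move=> y _; rewrite mule_ge0// lee_fin normal_pdf_ge0.
- by rewrite lee_fin normal_pdf_ge0.
Qed.

Let std_normal2_rot_neqN1 f (c s : R) : c ^+ 2 + s ^+ 2 = 1 -> c != -1 ->
  measurable_fun [set: R * R] f -> (forall z, 0 <= f z)%E ->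
  (\int[N2]_z f (rot2 c s z) = \int[N2]_z f z)%E.
Proof.
move=> cs c1 mf f0.
have mfr : measurable_fun [set: R * R] (f \o rot2 c s).
  by apply: measurableT_comp => //; exact: measurable_rot2.
rewrite (ge0_integral_std_normal2 mf f0).
rewrite (ge0_integral_std_normal2 mfr (fun z => f0 _)).
pose g (z : R * R) :=
  ((normal_peak 1 ^+ 2 * expR (- (z.1 ^+ 2 + z.2 ^+ 2) / 2))%:E * f z)%E.
have mg : measurable_fun [set: R * R] g.
  apply: emeasurable_funM => //; apply/measurable_EFinP.
  by solve_measurable.
have g0 z : (0 <= g z)%E.
  by rewrite mule_ge0// lee_fin mulr_ge0 ?expR_ge0// sqr_ge0.
transitivity (iint (g \o rot2 c s)); last exact: (iint_rot2 cs c1 mg g0).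
apply: eq_integral => x _; apply: eq_integral => y _ /=.
rewrite /g /rot2/=; congr ((_ * expR (- _ / 2))%:E * _)%E.
transitivity ((c ^+ 2 + s ^+ 2) * (x ^+ 2 + y ^+ 2)); last by ring.
by rewrite cs mul1r.
Qed.

Lemma ge0_integral_std_normal2_rot f (c s : R) : c ^+ 2 + s ^+ 2 = 1 ->
  measurable_fun [set: R * R] f -> (forall z, 0 <= f z)%E ->
  (\int[N2]_z f (rot2 c s z) = \int[N2]_z f z)%E.
Proof.
have [->|c1 cs mf f0] := eqVneq c (-1); last exact: std_normal2_rot_neqN1.
(* the half turn is the square of a quarter turn *)
move=> cs mf f0; have s0 : s = 0.
  by apply/eqP; rewrite -sqrf_eq0; apply/eqP; lra.
have mfr : measurable_fun [set: R * R] (f \o rot2 0 1).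
  by apply: measurableT_comp => //; exact: measurable_rot2.
have n01 : 0 != -1 :> R by rewrite eq_sym oppr_eq0 oner_eq0.
have e01 : 0 ^+ 2 + 1 ^+ 2 = 1 :> R by rewrite expr0n expr1n add0r.
rewrite -[RHS](std_normal2_rot_neqN1 e01 n01 mf f0).
rewrite -[RHS](std_normal2_rot_neqN1 e01 n01 mfr (fun z => f0 _)).
apply: eq_integral => z _; congr f; rewrite s0 /rot2/=.
by congr pair; ring.
Qed.

(** The coordinates of two independent standard bivariate normals may be
    regrouped by abscissas and ordinates. *)
Lemma ge0_integral_std_normal2_transpose (f : (R * R) * (R * R) -> \bar R) :
  measurable_fun [set: (R * R) * (R * R)] f -> (forall z, 0 <= f z)%E ->
  (\int[N2]_A \int[N2]_B f (A, B) =
   \int[N2]_u \int[N2]_v f ((u.1, v.1), (u.2, v.2)))%E.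
Proof.
move=> mf f0.
pose f' (z : (R * R) * (R * R)) := f ((z.1.1, z.2.1), (z.1.2, z.2.2)).
have mf' : measurable_fun [set: (R * R) * (R * R)] f'.
  by apply: measurableT_comp => //; solve_measurable.
(* both sides equal the iterated integral over a1, b1, a2, b2 of f ((a1, a2), (b1, b2)) *)
transitivity (\int[N]_a1 \int[N]_b1 \int[N]_a2 \int[N]_b2 f ((a1, a2), (b1, b2)))%E.
  have mF := measurable_integral_snd N2 mf f0.
  rewrite (integral_prodp N N mF (fun A => integral_ge0 _ (fun B _ => f0 _))).
  apply: eq_integral => a1 _.
  pose h (z : R * (R * R)) := f ((a1, z.1), z.2).
  have mh : measurable_fun [set: R * (R * R)] h.
    by apply: measurableT_comp => //; solve_measurable.
  have -> := integral_prob_swap N N2 mh (fun z => f0 _).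
  have mG := measurable_integral_fst N mh (fun z => f0 _).
  rewrite (integral_prodp N N mG (fun B => integral_ge0 _ (fun a2 _ => f0 _))).
  apply: eq_integral => b1 _.
  pose k (z : R * R) := f ((a1, z.1), (b1, z.2)).
  have mk : measurable_fun [set: R * R] k.
    by apply: measurableT_comp => //; solve_measurable.
  by have <- := integral_prob_swap N N mk (fun z => f0 _).
have mF' := measurable_integral_snd N2 mf' (fun z => f0 _).
have -> := integral_prodp N N mF' (fun A => integral_ge0 _ (fun B _ => f0 _)).
apply: eq_integral => a1 _; apply: eq_integral => b1 _.
pose k (z : R * R) := f ((a1, z.1), (b1, z.2)).
have mk : measurable_fun [set: R * R] k.
  by apply: measurableT_comp => //; solve_measurable.
by have -> := integral_prodp N N mk (fun z => f0 _).
Qed.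

(** Two independent standard bivariate normals may be rotated into each other,
    the rotation acting on the pair of first coordinates and on the pair of
    second coordinates. *)
Lemma ge0_integral_std_normal2_mix (f : (R * R) * (R * R) -> \bar R) (c s : R) :
  c ^+ 2 + s ^+ 2 = 1 ->
  measurable_fun [set: (R * R) * (R * R)] f -> (forall z, 0 <= f z)%E ->
  (\int[N2]_A \int[N2]_B f ((c * A.1 - s * B.1, c * A.2 - s * B.2)%R,
                            (s * A.1 + c * B.1, s * A.2 + c * B.2)%R) =
   \int[N2]_A \int[N2]_B f (A, B))%E.
Proof.
move=> cs mf f0.
pose f' (z : (R * R) * (R * R)) := f ((z.1.1, z.2.1), (z.1.2, z.2.2)).
have mf' : measurable_fun [set: (R * R) * (R * R)] f'.
  by apply: measurableT_comp => //; solve_measurable.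
pose fr (z : (R * R) * (R * R)) := f
  ((c * z.1.1 - s * z.2.1, c * z.1.2 - s * z.2.2), (s * z.1.1 + c * z.2.1, s * z.1.2 + c * z.2.2)).
have mfr : measurable_fun [set: (R * R) * (R * R)] fr.
  by apply: measurableT_comp => //; solve_measurable.
have := ge0_integral_std_normal2_transpose mfr (fun z => f0 _).
move=> ->.
have := ge0_integral_std_normal2_transpose mf f0.
move=> ->.
pose F u := (\int[N2]_v f' (u, v))%E.
have mF : measurable_fun [set: R * R] F by exact: (measurable_integral_snd N2 mf' (fun z => f0 _)).
have F0 u : (0 <= F u)%E by apply: integral_ge0 => v _; exact: f0.
transitivity (\int[N2]_u F (rot2 c s u))%E; last first.
  by have -> := ge0_integral_std_normal2_rot cs mF F0.
apply: eq_integral => u _.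
pose G v := f' (rot2 c s u, v).
have mG : measurable_fun [set: R * R] G.
  by apply: measurableT_comp => //; solve_measurable.
have h := ge0_integral_std_normal2_rot cs mG (fun z => f0 _).
exact h.
Qed.

End rotation.

(** * The squared norm of a standard bivariate normal point *)

Lemma measurable_indb d (T : measurableType d) (R : realType) (f : T -> bool) :
  measurable_fun [set: T] f -> measurable_fun [set: T] (fun x => (f x)%:R%:E : \bar R).
Proof.
move=> mf; have -> : (fun x => (f x)%:R%:E : \bar R) =
    (fun x => if f x then 1%E else 0%E).
  by apply/funext => x; case: (f x).
by apply: measurable_fun_ifT.
Qed.

Section radial_tail.
Context {R : realType}.
Local Notation mu := (@lebesgue_measure R).
Local Notation N := (std_normal R).
Local Notation N2 := (prodp N N).

Let is_derive_gauss (x : R) :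
  is_derive x 1 (fun x => - expR (- x ^+ 2 / 2)) (x * expR (- x ^+ 2 / 2)).
Proof.
have h : is_derive x (1 : R) (fun y => - y ^+ 2 / 2 : R) (- x).
  by apply: is_derive_eq; rewrite !scaler0 ?add0r/= /GRing.scale/=; field.
have h2 := @is_derive1_comp _ expR (fun y => - y ^+ 2 / 2 : R) x _ _ _ h.
by apply: is_derive_eq; rewrite -mulrN opprK mulrC.
Qed.

Let continuous_gauss : continuous (fun x : R => expR (- x ^+ 2 / 2)).
Proof.
move=> x; apply: (@continuous_comp _ _ _ (fun x : R => - x ^+ 2 / 2) expR).
  apply: cvgM; last exact: cvg_cst.
  by apply: cvgN; exact: exprn_continuous.
exact: continuous_expR.
Qed.

Let integral_xgauss (a : R) : 0 <= a ->
  (\int[mu]_(x in `]a, +oo[) (x * expR (- x ^+ 2 / 2))%:E = (expR (- a ^+ 2 / 2))%:E)%E.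
Proof.
move=> a0.
have cf : continuous (fun x : R => x * expR (- x ^+ 2 / 2)).
  move=> x; apply: cvgM; [exact: cvg_id|exact: continuous_gauss].
rewrite integral_itv_obnd_cbnd; last first.
  apply/measurable_EFinP; apply: measurable_funTS; exact: continuous_measurable_fun.
rewrite (@ge0_continuous_FTC2y _ _ (fun x => - expR (- x ^+ 2 / 2)) a 0)//.
- by rewrite sub0e -EFinN opprK.
- by move=> x ax; rewrite mulr_ge0 ?expR_ge0// (le_trans a0).
- exact: continuous_subspaceT.
- rewrite -[X in _ --> X]oppr0; apply: cvgN.
  under eq_cvg do rewrite mulNr.
  apply: (cvg_comp (fun x : R => x ^+ 2 / 2) (fun x => expR (- x))); last exact: cvgr_expR.
  by apply: gt0_cvgMly; [rewrite invr_gt0|exact: cvgr_expr2].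
- by apply: cvg_at_right_filter; apply: cvgN; exact: continuous_gauss.
- by move=> x _; rewrite derive1E; have [_ ->] := is_derive_gauss x.
Qed.

Let measurable_sumsq (H : R -> R) : measurable_fun [set: R] H ->
  measurable_fun [set: R * R] (fun z => (H (z.1 ^+ 2 + z.2 ^+ 2))%:E).
Proof.
move=> mH; apply/measurable_EFinP; apply: (measurableT_comp mH).
by solve_measurable.
Qed.

Let cauchy_gt0 (t : R) : 0 < 1 + t ^+ 2.
Proof. by rewrite ltr_pwDl// sqr_ge0. Qed.

Let integral_radial_rescale (H : R -> R) (t : R) :
  measurable_fun [set: R] H -> (forall u, 0 <= H u) ->
  (\int[mu]_x (`|x| * H (x ^+ 2 * (1 + t ^+ 2))%R)%:E =
   ((1 + t ^+ 2)^-1)%:E * \int[mu]_z (`|z| * H (z ^+ 2)%R)%:E)%E.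
Proof.
move=> mH H0.
have mJ : measurable_fun [set: R] (fun z => (`|z| * H (z ^+ 2))%:E).
  apply/measurable_EFinP; apply: measurable_funM; first exact: normr_measurable.
  by apply: (measurableT_comp mH); solve_measurable.
have J0 z : (0 <= (`|z| * H (z ^+ 2))%:E)%E by rewrite lee_fin mulr_ge0.
pose a : R := Num.sqrt (1 + t ^+ 2).
have a0 : 0 < a by rewrite sqrtr_gt0.
have a2 : a ^+ 2 = 1 + t ^+ 2 by rewrite sqr_sqrtr// ltW.
have an0 : a != 0 by rewrite gt_eqF.
have <- := @ge0_integral_lebesgue_affine _ _ a 0 an0 mJ J0.
rewrite muleA -EFinM -ge0_integralZl//.
- apply: eq_integral => x _; rewrite -EFinM; congr EFin.
  rewrite addr0 normrM (gtr0_norm a0) exprMn -a2 (mulrC (a ^+ 2) (x ^+ 2)).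
  by field.
- by apply: (measurableT_comp mJ); exact: measurable_affine.
- by rewrite lee_fin mulr_ge0// invr_ge0 ltW.
Qed.

(** For each fixed x the substitution y = x t and then, for each t, a rescaling
    of x turn a radial double integral into a one-dimensional one; the constant
    in front is the integral of the Cauchy density 1 / (1 + t ^ 2). *)
Let integral_radial (H : R -> R) :
  measurable_fun [set: R] H -> (forall u, 0 <= H u) ->
  (\int[mu]_x \int[mu]_y (H (x ^+ 2 + y ^+ 2)%R)%:E =
   (\int[mu]_t ((1 + t ^+ 2)^-1)%:E) * \int[mu]_z (`|z| * H (z ^+ 2)%R)%:E)%E.
Proof.
move=> mH H0.
pose k (z : R * R) := (`|z.1| * H (z.1 ^+ 2 * (1 + z.2 ^+ 2)))%:E.
have k0 z : (0 <= k z)%E by rewrite lee_fin mulr_ge0.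
have mk : measurable_fun [set: R * R] k.
  apply/measurable_EFinP; apply: measurable_funM.
    by apply: measurableT_comp; [exact: normr_measurable|solve_measurable].
  by apply: (measurableT_comp mH); solve_measurable.
have m2 := measurable_sumsq mH.
have H20 (z : R * R) : (0 <= (H (z.1 ^+ 2 + z.2 ^+ 2))%:E)%E by rewrite lee_fin.
(* the line x = 0, on which the substitution y = x t fails, is negligible *)
transitivity (\int[mu]_x \int[mu]_t k (x, t))%E.
  rewrite -[LHS](@integral_setD1 _ _ 0 setT); last 2 first.
    exact: measurableD.
    by apply: measurable_funTS; exact: (@measurable_fun_fubini_tonelli_F _ _ _ _ _ mu _ m2 H20).
  rewrite -[RHS](@integral_setD1 _ _ 0 setT); last 2 first.
    exact: measurableD.
    by apply: measurable_funTS; exact: (@measurable_fun_fubini_tonelli_F _ _ _ _ _ mu _ mk k0).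
  apply: eq_integral => x; rewrite inE /= => -[_ /eqP x0].
  have mHx : measurable_fun [set: R] (fun y => (H (x ^+ 2 + y ^+ 2))%:E).
    apply/measurable_EFinP; apply: (measurableT_comp mH).
    by solve_measurable.
  rewrite -(@ge0_integral_lebesgue_affine _ _ x 0 x0 mHx) -?ge0_integralZl//.
  - apply: eq_integral => t _; rewrite -EFinM /k/= addr0.
    by congr (_ * H _)%:E; ring.
  - apply/measurable_EFinP; apply: (measurableT_comp mH).
    by solve_measurable.
  - by move=> t _; rewrite lee_fin.
  - by move=> t; rewrite lee_fin.
have fub := @fubini_tonelli _ _ _ _ _ mu mu k mk k0.
transitivity (\int[mu]_t \int[mu]_x k (x, t))%E; first exact: fub.
rewrite -ge0_integralZr//; first last.
- by apply: integral_ge0 => z _; rewrite lee_fin mulr_ge0.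
- by move=> t _; rewrite lee_fin invr_ge0 ltW// cauchy_gt0.
- apply/measurable_EFinP; apply: continuous_measurable_fun => t.
  apply: cvgV; first by rewrite gt_eqF// cauchy_gt0.
  by apply: cvgD; [exact: cvg_cst|exact: exprn_continuous].
by apply: eq_integral => t _; exact: (integral_radial_rescale t mH H0).
Qed.

Let measurable_cutoff (s : R) :
  measurable_fun [set: R] (fun u => (s < u)%R%:R * expR (- u / 2)).
Proof.
apply: measurable_funM.
  by apply/measurable_EFinP; apply: measurable_indb; apply: measurable_fun_ltr.
by solve_measurable.
Qed.

Let cutoff_ge0 (s u : R) : 0 <= (s < u)%R%:R * expR (- u / 2).
Proof. by rewrite mulr_ge0 ?expR_ge0// ler0n. Qed.

(* for s < 0 the square root is 0, so that the cutoff is void *)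
Let integral_abs_gauss_tail (s : R) :
  (\int[mu]_z (`|z| * ((s < z ^+ 2)%R%:R * expR (- z ^+ 2 / 2)))%:E =
   (2 * expR (- Num.sqrt s ^+ 2 / 2))%:E)%E.
Proof.
pose h (z : R) : \bar R := (z * expR (- z ^+ 2 / 2))%:E.
pose g := (h \_ `]Num.sqrt s, +oo[)%classic.
have mh : measurable_fun [set: R] h.
  by apply/measurable_EFinP; solve_measurable.
have mg : measurable_fun [set: R] g.
  by apply/(measurable_restrictT h) => //; exact: measurable_funTS.
have g0 z : (0 <= g z)%E.
  rewrite /g patchE; case: ifPn => //; rewrite inE/= in_itv/= andbT => sz.
  by rewrite lee_fin mulr_ge0 ?expR_ge0// (le_trans (sqrtr_ge0 s))// ltW.
(* g is the part of the integrand on the positive half-line *)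
have gE z : 0 < z -> g z = (`|z| * ((s < z ^+ 2)%R%:R * expR (- z ^+ 2 / 2)))%:E.
  move=> z0; rewrite /g patchE mem_setE in_itv/= andbT.
  have -> : (Num.sqrt s < z) = (s < z ^+ 2).
    by rewrite -{1}(gtr0_norm z0) -sqrtr_sqr ltr_sqrt// exprn_gt0.
  by case: ifPn => _; rewrite ?mul0r ?mulr0// mul1r gtr0_norm.
have gN z : z <= 0 -> g z = 0%E.
  move=> z0; rewrite /g patchE mem_setE in_itv/= andbT ltNge.
  by rewrite (le_trans z0 (sqrtr_ge0 s)).
transitivity (\int[mu]_z (g z + g (- z)%R))%E.
  apply: eq_integral => z _; have [z0|z0|->] := ltgtP z 0.
  - by rewrite gN ?ltW// add0e gE ?oppr_gt0// normrN sqrrN.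
  - by rewrite (gN (- z)%R) ?oppr_le0 ?ltW// adde0 gE.
  - by rewrite oppr0 gN// normr0 mul0r adde0.
rewrite ge0_integralD//; last first.
  by apply: measurableT_comp => //; exact: measurable_funN.
rewrite ge0_integral_lebesgueN//.
rewrite /g -integral_mkcond integral_xgauss ?sqrtr_ge0//.
by rewrite -EFinD; congr EFin; ring.
Qed.

(** The squared norm of a standard bivariate normal is exponential with mean 2. *)
Lemma std_normal2_tail (s : R) : 0 <= s ->
  (\int[N2]_z (s < z.1 ^+ 2 + z.2 ^+ 2)%R%:R%:E = (expR (- s / 2))%:E)%E.
Proof.
pose C := (\int[mu]_t ((1 + t ^+ 2)^-1)%:E)%E.
pose p2 : R := normal_peak 1 ^+ 2.
have p20 : 0 <= p2 by rewrite sqr_ge0.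
have mt r : measurable_fun [set: R * R]
    (fun z : R * R => (r < z.1 ^+ 2 + z.2 ^+ 2)%R%:R%:E : \bar R).
  by apply: measurable_indb; apply: measurable_fun_ltr; solve_measurable.
have t0 r (z : R * R) : (0 <= (r < z.1 ^+ 2 + z.2 ^+ 2)%R%:R%:E :> \bar R)%E.
  by rewrite lee_fin ler0n.
have key r : (\int[N2]_z (r < z.1 ^+ 2 + z.2 ^+ 2)%R%:R%:E =
    (p2%:E * (C * 2%:E)) * (expR (- Num.sqrt r ^+ 2 / 2))%:E)%E.
  rewrite -!muleA -EFinM -integral_abs_gauss_tail.
  rewrite -(integral_radial (measurable_cutoff r) (cutoff_ge0 r)).
  rewrite ge0_integral_std_normal2//.
  have m2 := measurable_sumsq (measurable_cutoff r).
  have H20 (z : R * R) : (0 <= ((r < z.1 ^+ 2 + z.2 ^+ 2)%R%:R *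
      expR (- (z.1 ^+ 2 + z.2 ^+ 2) / 2))%:E)%E.
    by rewrite lee_fin.
  rewrite -ge0_integralZl//; last 2 first.
  - exact: (@measurable_fun_fubini_tonelli_F _ _ _ _ _ mu _ m2 H20).
  - by move=> x _; apply: integral_ge0 => y _; rewrite lee_fin.
  apply: eq_integral => x _.
  rewrite -ge0_integralZl//; last first.
    exact: (@measurable_fun_pair2 _ _ _ _ _ _ _ x m2).
  by apply: eq_integral => y _; rewrite -!EFinM/= mulrAC mulrA.
(* for r = -1 the event is certain, which gives the value of the constant *)
have norm1 : (p2%:E * (C * 2%:E) = 1)%E.
  have := key (-1); rewrite ler0_sqrtr ?lerN10// expr0n/= oppr0 mul0r expR0 mule1 => <-.
  rewrite -[RHS](integral_prob_cst N2).
  apply: eq_integral => z _ /=.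
  by rewrite (lt_le_trans (ltrN10 R))// addr_ge0// sqr_ge0.
by move=> s0; rewrite key norm1 mul1e sqr_sqrtr.
Qed.

(** The factor exp (- 3 x ^ 2 / 2) turns the standard normal density into the
    same density at 2 x. *)
Lemma std_normal_gauss3 :
  (\int[N]_x (expR (- (3 * x ^+ 2) / 2))%:E = (2^-1)%:E)%E.
Proof.
have mE : measurable_fun [set: R] (fun x : R => (expR (- (3 * x ^+ 2) / 2))%:E).
  by apply/measurable_EFinP; solve_measurable.
rewrite ge0_integral_std_normal//.
have mP : measurable_fun [set: R] (fun x : R => (normal_pdf 0 1 x)%:E).
  by apply/measurable_EFinP; exact: measurable_normal_pdf.
have P0 (x : R) : (0 <= (normal_pdf 0 1 x)%:E)%E by rewrite lee_fin normal_pdf_ge0.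
have n2 : 2 != 0 :> R by rewrite pnatr_eq0.
have := @ge0_integral_lebesgue_affine _ _ 2 0 n2 mP P0.
rewrite integral_normal_pdf ger0_norm// => h.
transitivity (\int[mu]_x (normal_pdf 0 1 (2 * x + 0)%R)%:E)%E.
  apply: eq_integral => x _; rewrite -EFinM !normal_pdfE ?oner_eq0//.
  rewrite /normal_fun -mulrA -expRD; congr (_ * expR _)%:E.
  by rewrite addr0 !subr0 expr1n -[1 *+ 2]/(2%:R); field.
rewrite -[LHS]mul1e -[X in (X%:E * _)%E](mulVf n2) EFinM -muleA h.
by rewrite mule1.
Qed.

(** If g and h are independent standard bivariate normals, then
    P(3 |g| ^ 2 < |h| ^ 2) = E exp (- 3 |g| ^ 2 / 2) = (1 / 2) ^ 2. *)
Lemma std_normal2_ratio :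
  (\int[N2]_h \int[N2]_g
     (3 * (g.1 ^+ 2 + g.2 ^+ 2) < h.1 ^+ 2 + h.2 ^+ 2)%R%:R%:E = (4^-1)%:E :> \bar R)%E.
Proof.
pose f (z : (R * R) * (R * R)) : \bar R :=
  (3 * (z.2.1 ^+ 2 + z.2.2 ^+ 2) < z.1.1 ^+ 2 + z.1.2 ^+ 2)%R%:R%:E.
have mf : measurable_fun [set: (R * R) * (R * R)] f.
  by apply: measurable_indb; apply: measurable_fun_ltr; solve_measurable.
have f0 z : (0 <= f z)%E by rewrite lee_fin ler0n.
transitivity (\int[N2]_g \int[N2]_h f (h, g))%E.
  have h := integral_prob_swap N2 N2 mf f0; exact: h.
pose e (x : R) := expR (- (3 * x ^+ 2) / 2).
have me : measurable_fun [set: R] e by rewrite /e; solve_measurable.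
have mee : measurable_fun [set: R * R] (fun g => (e g.1 * e g.2)%:E).
  apply/measurable_EFinP; apply: measurable_funM;
  by apply: (measurableT_comp me); solve_measurable.
transitivity (\int[N2]_g (e g.1 * e g.2)%:E)%E.
  apply: eq_integral => g _.
  rewrite (std_normal2_tail (s := 3 * (g.1 ^+ 2 + g.2 ^+ 2))).
    by rewrite /e -expRD; congr (expR _)%:E; ring.
  by rewrite mulr_ge0// addr_ge0// sqr_ge0.
rewrite integral_prodp//; last by move=> z; rewrite lee_fin mulr_ge0 ?expR_ge0.
transitivity (\int[N]_x ((e x)%:E * (2^-1)%:E))%E.
  apply: eq_integral => x _ /=.
  under eq_integral do rewrite EFinM.
  rewrite ge0_integralZl ?lee_fin ?expR_ge0//; last 2 first.
  - exact/measurable_EFinP.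
  - by move=> y _; rewrite lee_fin expR_ge0.
  by congr (_ * _)%E; exact: std_normal_gauss3.
rewrite ge0_integralZr ?lee_fin ?invr_ge0//; last 2 first.
- exact/measurable_EFinP.
- by move=> y _; rewrite lee_fin expR_ge0.
rewrite std_normal_gauss3 -EFinM; congr EFin; by field.
Qed.

End radial_tail.

(** * Polar decomposition *)

Section uniform_angle.
Context {R : realType}.
Local Notation mu := (@lebesgue_measure R).
Implicit Type h : R -> \bar R.

Let integral_shift_itv h (a p q : R) :
  measurable_fun [set: R] h -> (forall x, 0 <= h x)%E ->
  (\int[mu]_(x in `]p, q]) h (x + a)%R = \int[mu]_(x in `](p + a)%R, (q + a)%R]) h x)%E.
Proof.
move=> mh h0; rewrite integral_mkcond [RHS]integral_mkcond.
pose g := (h \_ `]p + a, q + a])%classic.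
have mg : measurable_fun [set: R] g.
  by apply/(measurable_restrictT h) => //; exact: measurable_funTS.
have g0 x : (0 <= g x)%E by rewrite /g patchE; case: ifPn.
rewrite -[RHS](@ge0_integral_lebesgue_shift _ g a)//.
apply: eq_integral => x _; rewrite /g !patchE !mem_setE !in_itv/=.
by rewrite ltrD2r lerD2r.
Qed.

Let integral_split_itv h (p q r : R) : p <= q -> q <= r ->
  measurable_fun [set: R] h -> (forall x, 0 <= h x)%E ->
  (\int[mu]_(x in `]p, r]) h x =
   \int[mu]_(x in `]p, q]) h x + \int[mu]_(x in `]q, r]) h x)%E.
Proof.
move=> pq qr mh h0.
have -> : `]p, r]%classic = `]p, q] `|` `]q, r] :> set R.
  by rewrite -itv_bndbnd_setU ?bnd_simp.
rewrite ge0_integral_setU//; first exact: measurable_funTS.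
apply/disj_setPS => x /=; rewrite !in_itv/= => -[/andP[_ xq] /andP[qx _]].
by move: (le_lt_trans xq qx); rewrite ltxx.
Qed.

Lemma integral_period h (T a : R) : 0 <= a -> a <= T ->
  measurable_fun [set: R] h -> (forall x, 0 <= h x)%E -> (forall x, h (x + T)%R = h x) ->
  (\int[mu]_(x in `]0%R, T]) h (x + a)%R = \int[mu]_(x in `]0%R, T]) h x)%E.
Proof.
move=> a0 aT mh h0 hT.
rewrite integral_shift_itv// add0r (@integral_split_itv _ a T (T + a))// ?lerDl//.
rewrite (@integral_split_itv _ 0 a T)// addeC; congr (_ + _)%E.
rewrite -[X in `]X, _]]add0r (addrC T a) -integral_shift_itv//.
by apply: eq_integral => x _; rewrite hT.
Qed.

Lemma integral_unif_angle h :
  measurable_fun [set: R] h -> (forall x, 0 <= h x)%E ->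
  (\int[unif_angle R]_t h t = ((2 * pi)^-1)%:E * \int[mu]_(x in `]0%R, (2 * pi)%R]) h x)%E.
Proof.
move=> mh h0; rewrite integral_uniform// subr0; congr (_ * _)%E.
by rewrite integral_itv_obnd_cbnd//; exact: measurable_funTS.
Qed.

Lemma integral_unif_angle_shift h (a : R) : 0 <= a -> a <= 2 * pi ->
  measurable_fun [set: R] h -> (forall x, 0 <= h x)%E ->
  (forall x, h (x + 2 * pi)%R = h x) ->
  (\int[unif_angle R]_t h (t + a)%R = \int[unif_angle R]_t h t)%E.
Proof.
move=> a0 api mh h0 hT; rewrite !integral_unif_angle//; last first.
  by apply: measurableT_comp => //; solve_measurable.
by rewrite integral_period.
Qed.

Lemma polar_form (z : R * R) : exists2 a : R, 0 <= a <= 2 * pi &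
  z = circle_point (enorm2 z) a.
Proof.
case: z => x y; rewrite /circle_point /enorm2 /dot2/=.
set r := Num.sqrt _.
have pi0 : 0 <= pi :> R by exact: pi_ge0.
have r2 : r ^+ 2 = x ^+ 2 + y ^+ 2.
  by rewrite sqr_sqrtr ?expr2// addr_ge0// -expr2 sqr_ge0.
have [r0|rn0] := eqVneq r 0.
  exists 0; first by rewrite lexx mulr_ge0.
  have /eqP : x ^+ 2 + y ^+ 2 = 0 by rewrite -r2 r0 expr0n.
  by rewrite paddr_eq0 ?sqr_ge0// !sqrf_eq0 r0 !mul0r => /andP[/eqP-> /eqP->].
have r0 : 0 < r by rewrite lt_def rn0 sqrtr_ge0.
have cs : (x / r) ^+ 2 + (y / r) ^+ 2 = 1.
  by rewrite !expr_div_n -mulrDl -r2 divff// expf_neq0.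
have c1 : -1 <= x / r <= 1.
  rewrite -ler_norml -(@ler_pXn2r _ 2)// ?nnegrE// expr1n -normrX ger0_norm ?sqr_ge0//.
  by rewrite -cs lerDl sqr_ge0.
have ca : cos (acos (x / r)) = x / r by rewrite acosK// in_itv.
have sa : sin (acos (x / r)) = `|y / r|.
  by rewrite sin_acos// -cs addrAC subrr add0r sqrtr_sqr.
have [y0|y0] := leP 0 y.
  exists (acos (x / r)).
    rewrite acos_ge0//= (le_trans (acos_lepi c1))//.
    by rewrite -[leLHS]mul1r ler_wpM2r// ler1n.
  by rewrite ca sa ger0_norm ?divr_ge0 ?(ltW r0)//; congr pair; field.
exists (- acos (x / r) + pi *+ 2).
  rewrite -(mulr_natl pi) gerDr oppr_le0 acos_ge0// andbT addrC subr_ge0.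
  rewrite (le_trans (acos_lepi c1))//.
  by rewrite -[leLHS]mul1r ler_wpM2r// ler1n.
rewrite cosD2pi sinD2pi cosN sinN ca sa.
rewrite ltr0_norm; last by rewrite pmulr_llt0// invr_gt0.
by rewrite opprK; congr pair; field.
Qed.

Lemma measurable_cos : measurable_fun [set: R] (@cos R).
Proof. by apply: continuous_measurable_fun; exact: continuous_cos. Qed.

Lemma measurable_sin : measurable_fun [set: R] (@sin R).
Proof. by apply: continuous_measurable_fun; exact: continuous_sin. Qed.

Lemma measurable_enorm2 : measurable_fun [set: R * R] (@enorm2 R).
Proof.
apply: (measurableT_comp (f := @Num.sqrt R)).
  by apply: continuous_measurable_fun; exact: sqrt_continuous.
by rewrite /dot2; solve_measurable.
Qed.

End uniform_angle.

(** [solve_measurable] extended to sines, cosines and Euclidean norms. *)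
Ltac solve_measurable_polar := repeat first
  [ progress solve_measurable
  | apply: (measurableT_comp measurable_cos) | apply: (measurableT_comp measurable_sin)
  | apply: (measurableT_comp measurable_enorm2)].

Section polar.
Context {R : realType}.
Local Notation N := (std_normal R).
Local Notation N2 := (prodp N N).
Local Notation U := (unif_angle R).

(** The polar decomposition of the standard bivariate normal law: its radius
    and an independent uniform angle determine it.  By rotation invariance the
    integral of f is that of f over randomly rotated points, and rotating a
    fixed point by a uniform angle gives a uniform point of its circle. *)
Lemma std_normal2_polar (f : R * R -> \bar R) :
  measurable_fun [set: R * R] f -> (forall z, 0 <= f z)%E ->
  (\int[N2]_G \int[U]_t f (circle_point (enorm2 G) t) = \int[N2]_G f G)%E.
Proof.
move=> mf f0.
pose k (z : R * (R * R)) := f (rot2 (cos z.1) (sin z.1) z.2).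
have mk : measurable_fun [set: R * (R * R)] k.
  by apply: (measurableT_comp mf); rewrite /rot2; solve_measurable_polar.
transitivity (\int[N2]_G \int[U]_t k (t, G))%E.
  apply: eq_integral => G _.
  have [a /andP[a0 a2pi] Ga] := polar_form G.
  pose h t := f (circle_point (enorm2 G) t).
  have mh : measurable_fun [set: R] h.
    by apply: (measurableT_comp mf); rewrite /circle_point; solve_measurable_polar.
  have hT x : h (x + 2 * pi) = h x.
    by rewrite /h /circle_point mulr_natl cosD2pi sinD2pi.
  have <- := integral_unif_angle_shift a0 a2pi mh (fun t => f0 _) hT.
  apply: eq_integral => t _; rewrite /k/= [in RHS]Ga /h; congr f.
  by rewrite /rot2 /circle_point/= cosD sinD; congr pair; ring.
have h := integral_prob_swap U N2 mk (fun z => f0 _).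
transitivity (\int[U]_t \int[N2]_G k (t, G))%E; first exact/esym/h.
rewrite -[RHS](integral_prob_cst U); apply: eq_integral => t _.
have h2 := ge0_integral_std_normal2_rot (cos2Dsin2 t) mf f0; exact: h2.
Qed.

Let measurable_polar d (S : measurableType d) :
  measurable_fun [set: (S * R) * (R * R)]
    (fun z => (z.1.1, circle_point (enorm2 z.2) z.1.2)).
Proof. by rewrite /circle_point; solve_measurable_polar. Qed.

(** The polar decomposition of one point, for a function that depends on a
    further independent parameter s. *)
Lemma std_normal2_polar_param d (S : measurableType d) (m : probability S R)
    (f : S * (R * R) -> \bar R) :
  measurable_fun [set: S * (R * R)] f -> (forall z, 0 <= f z)%E ->
  (\int[N2]_G \int[prodp m U]_st f (st.1, circle_point (enorm2 G) st.2) =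
   \int[m]_s \int[N2]_G f (s, G))%E.
Proof.
move=> mf f0.
pose k (z : (S * R) * (R * R)) := f (z.1.1, circle_point (enorm2 z.2) z.1.2).
have mk : measurable_fun [set: (S * R) * (R * R)] k.
  by apply: (measurableT_comp mf); exact: measurable_polar.
pose l (z : S * (R * R)) := (\int[U]_t k ((z.1, t), z.2))%E.
have ml : measurable_fun [set: S * (R * R)] l.
  pose k' (z : (S * (R * R)) * R) := k ((z.1.1, z.2), z.1.2).
  have mk' : measurable_fun [set: (S * (R * R)) * R] k'.
    by apply: (measurableT_comp mk); solve_measurable.
  exact: (measurable_integral_snd U mk' (fun z => f0 _)).
transitivity (\int[N2]_G \int[m]_s l (s, G))%E.
  apply: eq_integral => G _.
  pose kG (z : S * R) := k (z, G).
  have mkG : measurable_fun [set: S * R] kG.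
    by apply: (measurableT_comp mk); solve_measurable.
  have h := integral_prodp m U mkG (fun z => f0 _); exact: h.
have h := integral_prob_swap m N2 ml (fun z => integral_ge0 _ (fun t _ => f0 _)).
transitivity (\int[m]_s \int[N2]_G l (s, G))%E; first exact/esym/h.
apply: eq_integral => s _.
pose fs G := f (s, G).
have mfs : measurable_fun [set: R * R] fs.
  by apply: (measurableT_comp mf); solve_measurable.
have h2 := std_normal2_polar mfs (fun z => f0 _); exact: h2.
Qed.

Local Notation cp G t := (circle_point (enorm2 G) t).

Lemma std_normal2_polar3 (F : ((R * R) * (R * R)) * (R * R) -> \bar R) :
  measurable_fun [set: ((R * R) * (R * R)) * (R * R)] F -> (forall z, 0 <= F z)%E ->
  (\int[N2]_G1 \int[N2]_G2 \int[N2]_G3 \int[prodp (prodp U U) U]_t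
     F ((cp G1 t.1.1, cp G2 t.1.2), cp G3 t.2) =
   \int[N2]_G1 \int[N2]_G2 \int[N2]_G3 F ((G1, G2), G3))%E.
Proof.
move=> mF F0.
pose F2 (z : (R * R) * (R * R)) := (\int[N2]_G3 F (z, G3))%E.
have mF2 : measurable_fun [set: (R * R) * (R * R)] F2.
  exact: (measurable_integral_snd N2 mF F0).
have F20 z : (0 <= F2 z)%E by apply: integral_ge0 => G _; exact: F0.
pose F1 (z : R * R) := (\int[N2]_G2 F2 (z, G2))%E.
have mF1 : measurable_fun [set: R * R] F1.
  exact: (measurable_integral_snd N2 mF2 F20).
have F10 z : (0 <= F1 z)%E by apply: integral_ge0 => G _; exact: F20.
have h := std_normal2_polar mF1 F10.
transitivity (\int[N2]_G1 \int[U]_t F1 (cp G1 t))%E; last exact: h.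
apply: eq_integral => G1 _.
pose f2 (z : R * (R * R)) := F2 (cp G1 z.1, z.2).
have mf2 : measurable_fun [set: R * (R * R)] f2.
  by apply: (measurableT_comp mF2); rewrite /circle_point; solve_measurable_polar.
have h2 := std_normal2_polar_param U mf2 (fun z => F20 _).
transitivity (\int[N2]_G2 \int[prodp U U]_st f2 (st.1, cp G2 st.2))%E; last exact: h2.
apply: eq_integral => G2 _.
pose f3 (z : (R * R) * (R * R)) := F ((cp G1 z.1.1, cp G2 z.1.2), z.2).
have mf3 : measurable_fun [set: (R * R) * (R * R)] f3.
  by apply: (measurableT_comp mF); rewrite /circle_point; solve_measurable_polar.
have h3 := std_normal2_polar_param (prodp U U) mf3 (fun z => F0 _).
exact: h3.
Qed.

End polar.

(** * The probability of an obtuse angle at a given vertex *)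

Section obtuse_angle_probability.
Context {R : realType}.
Local Notation N := (std_normal R).
Local Notation N2 := (prodp N N).

Lemma measurable_obtuse_at d (T : measurableType d) (V A B : T -> R * R) :
  measurable_fun [set: T] V -> measurable_fun [set: T] A -> measurable_fun [set: T] B ->
  measurable_fun [set: T] (fun t => (dot2 (A t - V t) (B t - V t) < 0)%R%:R%:E : \bar R).
Proof.
move=> mV mA mB; apply: measurable_indb; apply: measurable_fun_ltr => //.
by rewrite /dot2/=; solve_measurable.
Qed.

(* r ^+ 2 * (A + B) is the midpoint of A and B *)
Let obtuse_at_circle (r : R) (A B V : R * R) : r ^+ 2 = 2^-1 ->
  (dot2 (A - V) (B - V) < 0) =
  ((r * (r * A.1 + r * B.1) - V.1) ^+ 2 + (r * (r * A.2 + r * B.2) - V.2) ^+ 2 <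
   2^-1 * ((r * A.1 - r * B.1) ^+ 2 + (r * A.2 - r * B.2) ^+ 2)).
Proof.
move=> r2; rewrite -[RHS]subr_lt0; congr (_ < 0).
have e (x y v : R) : (r * (r * x + r * y) - v) ^+ 2 - 2^-1 * (r * x - r * y) ^+ 2 =
    (x - v) * (y - v).
  transitivity ((r ^+ 2 * (x + y) - v) ^+ 2 - 2^-1 * (r ^+ 2 * (x - y) ^+ 2)); first ring.
  by rewrite r2; field.
rewrite /dot2/= -(e A.1) -(e A.2); ring.
Qed.

Let circle_rescale (r s : R) (k V : R * R) (t : R) : s ^+ 2 = 2 / 3 ->
  ((r * k.1 - V.1) ^+ 2 + (r * k.2 - V.2) ^+ 2 < 2^-1 * t) =
  (3 * ((s * r * k.1 - s * V.1) ^+ 2 + (s * r * k.2 - s * V.2) ^+ 2) < t).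
Proof.
move=> s2.
have e (x v : R) : (s * r * x - s * v) ^+ 2 = 2 / 3 * (r * x - v) ^+ 2.
  by rewrite -s2; ring.
rewrite !e -mulrDr mulrA; set u := _ + _.
by apply/idP/idP => ?; lra.
Qed.

(** The angle at V is obtuse exactly when V lies inside the circle of diameter
    AB; after two rotations mixing A with B, and then A + B with V, this
    becomes 3 |g| ^ 2 < |h| ^ 2 for independent standard normals g and h. *)
Lemma std_normal2_obtuse_at :
  (\int[N2]_A \int[N2]_B \int[N2]_V
     (dot2 (A - V)%R (B - V)%R < 0)%R%:R%:E = (4^-1)%:E :> \bar R)%E.
Proof.
(* r and s are such that r ^+ 2 + r ^+ 2 = 1 and (s * r) ^+ 2 + s ^+ 2 = 1 *)
pose r : R := Num.sqrt 2^-1; pose s : R := Num.sqrt (2 / 3).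
have r2 : r ^+ 2 = 2^-1 by rewrite sqr_sqrtr// invr_ge0.
have s2 : s ^+ 2 = 2 / 3 by rewrite sqr_sqrtr// divr_ge0.
pose Phi (z : ((R * R) * (R * R)) * (R * R)) : \bar R :=
  ((r * z.1.2.1 - z.2.1) ^+ 2 + (r * z.1.2.2 - z.2.2) ^+ 2 <
   2^-1 * (z.1.1.1 ^+ 2 + z.1.1.2 ^+ 2))%R%:R%:E.
have mPhi : measurable_fun [set: ((R * R) * (R * R)) * (R * R)] Phi.
  by apply: measurable_indb; apply: measurable_fun_ltr; solve_measurable.
have Phi0 z : (0 <= Phi z)%E by rewrite lee_fin ler0n.
pose F z := (\int[N2]_V Phi (z, V))%E.
have mF : measurable_fun [set: (R * R) * (R * R)] F.
  exact: (measurable_integral_snd N2 mPhi Phi0).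
have F0 z : (0 <= F z)%E by apply: integral_ge0 => V _; exact: Phi0.
have rr : r ^+ 2 + r ^+ 2 = 1 by rewrite r2; field.
have h := ge0_integral_std_normal2_mix rr mF F0.
transitivity (\int[N2]_h \int[N2]_k F (h, k))%E.
  rewrite -h; apply: eq_integral => A _; apply: eq_integral => B _.
  apply: eq_integral => V _; congr (nat_of_bool _)%:R%:E.
  exact: obtuse_at_circle.
rewrite -std_normal2_ratio; apply: eq_integral => hh _.
pose Psi (z : (R * R) * (R * R)) : \bar R :=
  (3 * (z.1.1 ^+ 2 + z.1.2 ^+ 2) < hh.1 ^+ 2 + hh.2 ^+ 2)%R%:R%:E.
have mPsi : measurable_fun [set: (R * R) * (R * R)] Psi.
  by apply: measurable_indb; apply: measurable_fun_ltr; solve_measurable.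
have Psi0 z : (0 <= Psi z)%E by rewrite lee_fin ler0n.
have srs : (s * r) ^+ 2 + s ^+ 2 = 1 by rewrite exprMn r2 s2; field.
have h2 := ge0_integral_std_normal2_mix srs mPsi Psi0.
transitivity (\int[N2]_g \int[N2]_w Psi (g, w))%E.
  rewrite -h2; apply: eq_integral => k _; apply: eq_integral => V _.
  congr (nat_of_bool _)%:R%:E; exact: circle_rescale.
(* Psi does not depend on its second argument *)
apply: eq_integral => g _.
have h3 := integral_prob_cst N2 (Psi (g, (0, 0)%R)); exact: h3.
Qed.

End obtuse_angle_probability.

Section obtuse.
Context {R : realType}.
Implicit Types A B C V : R * R.

Lemma enorm2_gt0 V : (0 < enorm2 V) = (V != 0).
Proof.
case: V => x y; rewrite /enorm2 /dot2/= sqrtr_gt0 -!expr2 lt_def addr_ge0 ?sqr_ge0// andbT.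
by rewrite paddr_eq0 ?sqr_ge0// !sqrf_eq0 -pair_eqE.
Qed.

Lemma dot2_normr_le u v : `|dot2 u v| <= enorm2 u * enorm2 v :> R.
Proof.
rewrite -(@ler_pXn2r _ 2)// ?nnegrE ?mulr_ge0 ?sqrtr_ge0// exprMn !sqr_sqrtr; last 2 first.
- by rewrite /dot2 addr_ge0// -expr2 sqr_ge0.
- by rewrite /dot2 addr_ge0// -expr2 sqr_ge0.
rewrite -normrX ger0_norm ?sqr_ge0// -subr_ge0.
(* Lagrange identity *)
have -> : dot2 u u * dot2 v v - dot2 u v ^+ 2 = (det2 u v) ^+ 2.
  by rewrite /dot2 /det2; ring.
exact: sqr_ge0.
Qed.

Lemma obtuse_angle_at V A B : A != V -> B != V ->
  (pi / 2 < angle_at V A B) = (dot2 (A - V) (B - V) < 0).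
Proof.
move=> AV BV; rewrite /angle_at.
set a := enorm2 _; set b := enorm2 _.
have a0 : 0 < a by rewrite enorm2_gt0 subr_eq0.
have b0 : 0 < b by rewrite enorm2_gt0 subr_eq0.
have ab0 : 0 < a * b by rewrite mulr_gt0.
set x := dot2 _ _ / _.
have x1 : -1 <= x <= 1.
  by rewrite -ler_norml /x normf_div (gtr0_norm ab0) ler_pdivrMr// mul1r dot2_normr_le.
have pi0 : 0 <= pi :> R by exact: pi_ge0.
have -> : (pi / 2 < acos x) = (cos (acos x) < cos (pi / 2)).
  rewrite ltr_cos// in_itv/= ?acos_ge0 ?acos_lepi//.
  by rewrite divr_ge0//= ler_piMr// invf_le1// ler1n.
by rewrite acosK ?in_itv// cos_pihalf /x pmulr_llt0// invr_gt0.
Qed.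

Lemma obtuse_triangleE A B C : det2 (B - A) (C - A) != 0 ->
  obtuse_triangle A B C <->
  [|| dot2 (B - A) (C - A) < 0, dot2 (C - B) (A - B) < 0 | dot2 (A - C) (B - C) < 0].
Proof.
move=> dn0.
have AB : A != B.
  by apply: contra_neq dn0 => ->; rewrite /det2/=; ring.
have AC : A != C.
  by apply: contra_neq dn0 => ->; rewrite /det2/=; ring.
have BC : B != C.
  by apply: contra_neq dn0 => ->; rewrite /det2/=; ring.
rewrite /obtuse_triangle /nondegenerate_triangle.
have [BA CA CB] : [/\ B != A, C != A & C != B] by rewrite !(eq_sym _ A) (eq_sym C).
rewrite !obtuse_angle_at//.
by split => [[_ /or3P]//|/or3P].
Qed.

(** A triangle has at most one obtuse angle: the dot products at two vertices
    add up to the squared length of the side that joins them. *)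
Lemma obtuse_at_le1 A B C :
  let a := dot2 (B - A) (C - A) < 0 in
  let b := dot2 (C - B) (A - B) < 0 in
  let c := dot2 (A - C) (B - C) < 0 in
  (a + b + c)%N = [|| a, b | c] :> nat.
Proof.
move=> /=; set a := dot2 _ _; set b := dot2 _ _; set c := dot2 _ _.
have ab : 0 <= a + b.
  have -> : a + b = (B.1 - A.1) ^+ 2 + (B.2 - A.2) ^+ 2 by rewrite /a /b /dot2/=; ring.
  by rewrite addr_ge0// sqr_ge0.
have bc : 0 <= b + c.
  have -> : b + c = (C.1 - B.1) ^+ 2 + (C.2 - B.2) ^+ 2 by rewrite /b /c /dot2/=; ring.
  by rewrite addr_ge0// sqr_ge0.
have ac : 0 <= a + c.
  have -> : a + c = (C.1 - A.1) ^+ 2 + (C.2 - A.2) ^+ 2 by rewrite /a /c /dot2/=; ring.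
  by rewrite addr_ge0// sqr_ge0.
by case: (ltP a 0) => a0; case: (ltP b 0) => b0; case: (ltP c 0) => c0 //; exfalso; lra.
Qed.

End obtuse.

(** * The probability of an obtuse triangle *)

Section obtuse_probability.
Context {R : realType}.
Local Notation N := (std_normal R).
Local Notation N2 := (prodp N N).
Local Notation M3 := (prodp (prodp N2 N2) N2).
Local Notation T3 := (((R * R) * (R * R)) * (R * R))%type.

Let integral_M3 (f : T3 -> \bar R) :
  measurable_fun [set: T3] f -> (forall z, 0 <= f z)%E ->
  (\int[M3]_z f z = \int[N2]_A \int[N2]_B \int[N2]_C f ((A, B), C))%E.
Proof.
move=> mf f0.
have h := integral_prodp (prodp N2 N2) N2 mf f0.
transitivity (\int[prodp N2 N2]_z \int[N2]_C f (z, C))%E; first exact: h.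
have mF := measurable_integral_snd N2 mf f0.
have h2 := integral_prodp N2 N2 mF (fun z => integral_ge0 _ (fun C _ => f0 _)).
exact: h2.
Qed.

Lemma std_normal_point (c : R) : (\int[N]_x (x == c)%:R%:E = 0 :> \bar R)%E.
Proof.
transitivity (\int[N]_x (\1_[set c] x)%:E)%E.
  apply: eq_integral => x _; rewrite indicE; congr (nat_of_bool _)%:R%:E.
  by apply/eqP/idP => [->|]; rewrite inE.
rewrite integral_indic// setIT.
transitivity (\int[lebesgue_measure]_(x in [set c]) (normal_pdf 0 1 x)%:E)%E => //.
exact: integral_set1.
Qed.

Let det (z : T3) : R := det2 (z.1.2 - z.1.1) (z.2 - z.1.1).
Let some_obtuse (z : T3) := [|| dot2 (z.1.2 - z.1.1) (z.2 - z.1.1) < 0,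
  dot2 (z.2 - z.1.2) (z.1.1 - z.1.2) < 0 | dot2 (z.1.1 - z.2) (z.1.2 - z.2) < 0].

Let measurable_det : measurable_fun [set: T3] det.
Proof. by rewrite /det /det2/=; solve_measurable. Qed.

Let measurable_dot (u v w : T3 -> R * R) :
  measurable_fun [set: T3] u -> measurable_fun [set: T3] v -> measurable_fun [set: T3] w ->
  measurable_fun [set: T3] (fun z => dot2 (v z - u z) (w z - u z) < 0).
Proof.
move=> mu mv mw; apply: measurable_fun_ltr => //.
by rewrite /dot2/=; solve_measurable.
Qed.

Let measurable_p1 : measurable_fun [set: T3] (fun z : T3 => z.1.1).
Proof. by solve_measurable. Qed.
Let measurable_p2 : measurable_fun [set: T3] (fun z : T3 => z.1.2).
Proof. by solve_measurable. Qed.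
Let measurable_p3 : measurable_fun [set: T3] (fun z : T3 => z.2).
Proof. by solve_measurable. Qed.

Let measurable_some_obtuse : measurable_fun [set: T3] some_obtuse.
Proof. by apply: measurable_or; [|apply: measurable_or]; exact: measurable_dot. Qed.

(** The indicator of the obtuse (non-degenerate) triangles. *)
Definition obtuse_indic (z : T3) : \bar R := ((det z != 0) && some_obtuse z)%:R%:E.

Lemma obtuse_indicE z :
  obtuse_indic z = (\1_[set z : T3 | obtuse_triangle z.1.1 z.1.2 z.2] z)%:E.
Proof.
rewrite /obtuse_indic indicE; congr (nat_of_bool _)%:R%:E.
apply/idP/idP; rewrite inE/=.
  by move=> /andP[d0 az]; apply/obtuse_triangleE.
by move=> oz; have d0 := oz.1; rewrite -/(det z) in d0; rewrite d0/=; apply/obtuse_triangleE.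
Qed.

Lemma obtuse_indic_ge0 z : (0 <= obtuse_indic z)%E.
Proof. by rewrite lee_fin ler0n. Qed.

Lemma measurable_obtuse_indic : measurable_fun [set: T3] obtuse_indic.
Proof.
apply: measurable_indb; apply: measurable_and => //.
by apply: measurable_neg; apply: measurable_fun_eqr.
Qed.

(** Three independent standard bivariate normals are almost surely not collinear:
    the first two almost surely have distinct abscissas, and then each value of
    the abscissa of the third leaves a single value for its ordinate. *)
Lemma std_normal2_degenerate (b : T3 -> bool) : measurable_fun [set: T3] b ->
  (\int[M3]_z ((det z == 0) && b z)%:R%:E = 0 :> \bar R)%E.
Proof.
move=> mb.
pose E1 (z : T3) : \bar R := (z.1.2.1 == z.1.1.1)%:R%:E.
pose E2 (z : T3) : \bar R := ((z.1.2.1 != z.1.1.1) && (det z == 0))%:R%:E.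
have mx : measurable_fun [set: T3] (fun z : T3 => z.1.2.1 == z.1.1.1).
  by apply: measurable_fun_eqr; solve_measurable.
have md : measurable_fun [set: T3] (fun z : T3 => det z == 0).
  exact: measurable_fun_eqr.
have mE1 : measurable_fun [set: T3] E1 by exact: measurable_indb.
have mE2 : measurable_fun [set: T3] E2.
  apply: measurable_indb; apply: measurable_and => //.
  exact: measurable_neg.
have E10 z : (0 <= E1 z)%E by rewrite lee_fin ler0n.
have E20 z : (0 <= E2 z)%E by rewrite lee_fin ler0n.
have i1 : (\int[M3]_z E1 z = 0)%E.
  rewrite integral_M3//; apply: integral0_eq => A _.
  transitivity (\int[N2]_B (B.1 == A.1)%:R%:E : \bar R)%E.
    apply: eq_integral => B _; have h := integral_prob_cst N2 (B.1 == A.1)%:R%:E; exact: h.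
  have mf : measurable_fun [set: R * R] (fun B : R * R => (B.1 == A.1)%:R%:E : \bar R).
    by apply: measurable_indb; apply: measurable_fun_eqr; solve_measurable.
  rewrite integral_prodp//.
  rewrite -(std_normal_point A.1); apply: eq_integral => x _.
  have h := integral_prob_cst N (x == A.1)%:R%:E; exact: h.
have i2 : (\int[M3]_z E2 z = 0)%E.
  rewrite integral_M3//; apply: integral0_eq => A _; apply: integral0_eq => B _.
  pose f C := E2 ((A, B), C).
  have mf : measurable_fun [set: R * R] f by apply: (measurableT_comp mE2); solve_measurable.
  have -> := integral_prodp N N mf (fun C => E20 _).
  apply: integral0_eq => x _.
  have [a0|a0] := eqVneq B.1 A.1.
    by apply: integral0_eq => y _; rewrite /f /E2/= a0 eqxx.
  rewrite -(std_normal_point ((B.2 - A.2) * (x - A.1) / (B.1 - A.1) + A.2)).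
  apply: eq_integral => y _; congr (nat_of_bool _)%:R%:E.
  have a0' : B.1 - A.1 != 0 by rewrite subr_eq0.
  rewrite /= a0 /det /det2/=; apply/eqP/eqP => [/eqP|->]; last by field.
  rewrite subr_eq0 => /eqP e; apply/eqP; rewrite -subr_eq; apply/eqP.
  by apply: (mulfI a0'); rewrite e; field.
apply/eqP; rewrite eq_le; apply/andP; split; last first.
  by apply: integral_ge0 => z _; rewrite lee_fin ler0n.
apply: (@le_trans _ _ (\int[M3]_z (E1 z + E2 z))%E).
  apply: ge0_le_integral => //.
  - by apply: measurable_indb; apply: measurable_and.
  - exact: emeasurable_funD.
  - move=> z _; rewrite /E1 /E2 -EFinD lee_fin.
    by case: (z.1.2.1 == _); case: (det z == 0); case: (b z); rewrite /= ?addr0 ?add0r ?lexx ?ler01.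
by rewrite ge0_integralD// i1 i2 adde0.
Qed.

Lemma std_normal2_obtuse :
  (\int[N2]_A \int[N2]_B \int[N2]_C obtuse_indic ((A, B), C) = (3 / 4)%:E)%E.
Proof.
pose q (V A B : R * R) : \bar R := (dot2 (A - V) (B - V) < 0)%R%:R%:E.
have q0 V A B : (0 <= q V A B)%E by rewrite lee_fin ler0n.
have mq d (T : measurableType d) (V A B : T -> R * R) :
  measurable_fun [set: T] V -> measurable_fun [set: T] A -> measurable_fun [set: T] B ->
  measurable_fun [set: T] (fun z => q (V z) (A z) (B z)) by exact: measurable_obtuse_at.
pose q1 (z : T3) := q z.1.1 z.1.2 z.2.
pose q2 (z : T3) := q z.1.2 z.2 z.1.1.
pose q3 (z : T3) := q z.2 z.1.1 z.1.2.
have mq1 : measurable_fun [set: T3] q1 by exact: mq.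
have mq2 : measurable_fun [set: T3] q2 by exact: mq.
have mq3 : measurable_fun [set: T3] q3 by exact: mq.
have qE V A B : q V A B = q V B A.
  by rewrite /q /dot2; congr ((_ < _)%R%:R%:E); ring.
have i3 : (\int[N2]_A \int[N2]_B \int[N2]_V q V A B = (4^-1)%:E)%E.
  exact: std_normal2_obtuse_at.
have i2 : (\int[N2]_A \int[N2]_V \int[N2]_B q V A B = (4^-1)%:E)%E.
  rewrite -i3; apply: eq_integral => A _.
  pose f (z : (R * R) * (R * R)) := q z.1 A z.2.
  have mf : measurable_fun [set: (R * R) * (R * R)] f by apply: mq; solve_measurable.
  have h := integral_prob_swap N2 N2 mf (fun z => q0 _ _ _); exact: h.
have i1 : (\int[N2]_V \int[N2]_A \int[N2]_B q V A B = (4^-1)%:E)%E.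
  rewrite -i2.
  pose f (z : T3) := q z.1.1 z.1.2 z.2.
  have mf : measurable_fun [set: T3] f by exact: mq.
  have mF := measurable_integral_snd N2 mf (fun z => q0 _ _ _).
  have h := integral_prob_swap N2 N2 mF (fun z => integral_ge0 _ (fun B _ => q0 _ _ _)).
  exact: h.
have j1 : (\int[M3]_z q1 z = (4^-1)%:E)%E.
  by rewrite (integral_M3 mq1 (fun z => q0 _ _ _)); exact: i1.
have j2 : (\int[M3]_z q2 z = (4^-1)%:E)%E.
  rewrite (integral_M3 mq2 (fun z => q0 _ _ _)) -i2.
  apply: eq_integral => A _; apply: eq_integral => V _.
  by apply: eq_integral => B _; rewrite /q2 qE.
have j3 : (\int[M3]_z q3 z = (4^-1)%:E)%E.
  by rewrite (integral_M3 mq3 (fun z => q0 _ _ _)); exact: i3.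
have mo := measurable_obtuse_indic.
pose D (z : T3) : \bar R := ((det z == 0) && some_obtuse z)%:R%:E.
have mD : measurable_fun [set: T3] D.
  by apply: measurable_indb; apply: measurable_and => //; exact: measurable_fun_eqr.
have D0 z : (0 <= D z)%E by rewrite lee_fin ler0n.
(* D accounts for the degenerate triangles with a negative dot product *)
have e : (\int[M3]_z (q1 z + q2 z + q3 z) = \int[M3]_z (obtuse_indic z + D z))%E.
  apply: eq_integral => z _; rewrite /q1 /q2 /q3 /q /obtuse_indic /D -!EFinD -!natrD.
  rewrite (obtuse_at_le1 z.1.1 z.1.2 z.2) -/(some_obtuse z).
  by case: (det z == 0); case: (some_obtuse z).
rewrite -integral_M3//; last exact: obtuse_indic_ge0.
have q10 z : (0 <= q1 z)%E by exact: q0.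
have q20 z : (0 <= q2 z)%E by exact: q0.
have q30 z : (0 <= q3 z)%E by exact: q0.
have o0 (z : T3) : (0 <= obtuse_indic z)%E by exact: obtuse_indic_ge0.
have q120 z : (0 <= q1 z + q2 z)%E by rewrite adde_ge0.
have mq12 : measurable_fun [set: T3] (q1 \+ q2)%E by exact: emeasurable_funD.
move: e; rewrite !ge0_integralD// ?j1 ?j2 ?j3.
rewrite std_normal2_degenerate// adde0 => <-.
by rewrite -!EFinD; congr EFin; field.
Qed.

End obtuse_probability.

(** * Independent Rayleigh variables *)

Section independence.
Context {R : realType}.

Lemma measurable_mfun_pair d d1 d2 (T : measurableType d) (S1 : measurableType d1)
    (S2 : measurableType d2) (X : {mfun T >-> S1}) (Y : {mfun T >-> S2}) :
  measurable_fun [set: T] (fun w => (X w, Y w)).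
Proof. by apply: measurable_fun_pair; exact: measurable_funPT. Qed.

(** The pair of two measurable functions, bundled as a measurable function. *)
Definition mfun_pair d d1 d2 (T : measurableType d) (S1 : measurableType d1)
    (S2 : measurableType d2) (X : {mfun T >-> S1}) (Y : {mfun T >-> S2}) :
    {mfun T >-> (S1 * S2)%type} :=
  HB.pack (fun w => (X w, Y w))
    (isMeasurableFun.Build _ _ _ _ _ (measurable_mfun_pair X Y)).

(** The joint law of an independent pair is the product of the two laws. *)
Lemma integral_independent_pair d d1 d2 (T : measurableType d) (S1 : measurableType d1)
    (S2 : measurableType d2) (P : probability T R) (X : {mfun T >-> S1}) (Y : {mfun T >-> S2}) :
  (forall A B, measurable A -> measurable B ->
    P (X @^-1` A `&` Y @^-1` B) = (P (X @^-1` A) * P (Y @^-1` B))%E) ->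
  forall g : S1 * S2 -> \bar R, measurable_fun [set: S1 * S2] g -> (forall z, 0 <= g z)%E ->
  (\int[P]_w g (X w, Y w) =
   \int[distribution P X]_x \int[distribution P Y]_y g (x, y))%E.
Proof.
move=> indep g mg g0.
have h := integral_prodp (distribution P X) (distribution P Y) mg g0.
transitivity (\int[prodp (distribution P X) (distribution P Y)]_z g z)%E; last exact: h.
apply/esym/(ge0_integral_image (measurable_mfun_pair X Y)) => // A mA.
have h2 := @product_measure_unique _ _ _ _ _ (distribution P X) (distribution P Y)
  (distribution P (mfun_pair X Y)).
by apply: h2 => // B C mB mC; exact: indep.
Qed.

Lemma integral_distribution d d1 (T : measurableType d) (S : measurableType d1)
    (P : probability T R) (X : {mfun T >-> S}) (g : S -> \bar R) :
  measurable_fun [set: S] g -> (forall z, 0 <= g z)%E ->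
  (\int[distribution P X]_x g x = \int[P]_w g (X w))%E.
Proof.
move=> mg g0; apply: (ge0_integral_image (g := X)) => //; exact: measurable_funPT.
Qed.

Lemma integral_rayleigh d (T : measurableType d) (P : probability T R) (X : {RV P >-> R})
    (g : R -> \bar R) : is_rayleigh X ->
  measurable_fun [set: R] g -> (forall z, 0 <= g z)%E ->
  (\int[distribution P X]_x g x =
   \int[prodp (std_normal R) (std_normal R)]_G g (enorm2 G))%E.
Proof.
move=> rX mg g0.
have h := @ge0_integral_image _ _ _ _ R (prodp (std_normal R) (std_normal R))
  (distribution P X) (@enorm2 R) measurable_enorm2 rX g mg g0.
exact: h.
Qed.

(** The pushforward, bundled as a measure from a proof of measurability. *)
Definition image_measure d d' (T : measurableType d) (S : measurableType d')
    (m : {measure set T -> \bar R}) (f : T -> S) (mf : measurable_fun [set: T] f) :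
    {measure set S -> \bar R} :=
  measure_function_pushforward__canonical__measure_function_Measure m mf.

(** If the rectangle events of (X, Y) are independent of Z then the pair (X, Y)
    is independent of Z. *)
Lemma independent_pair_third d d1 d2 d3 (T : measurableType d) (S1 : measurableType d1)
    (S2 : measurableType d2) (S3 : measurableType d3) (P : probability T R)
    (X : {mfun T >-> S1}) (Y : {mfun T >-> S2}) (Z : {mfun T >-> S3}) :
  (forall A B C, measurable A -> measurable B -> measurable C ->
    P (X @^-1` A `&` Y @^-1` B `&` Z @^-1` C) =
    (P (X @^-1` A `&` Y @^-1` B) * P (Z @^-1` C))%E) ->
  forall E C, measurable E -> measurable C ->
    P (mfun_pair X Y @^-1` E `&` Z @^-1` C) =
    (P (mfun_pair X Y @^-1` E) * P (Z @^-1` C))%E.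
Proof.
move=> indep E C mE mC.
have mZC : measurable (Z @^-1` C) by rewrite -[X in measurable X]setTI; exact: measurable_funPT.
have Pfin : P (Z @^-1` C) \is a fin_num by exact: fin_num_measure.
have k0 : 0 <= fine (P (Z @^-1` C)) by rewrite fine_ge0.
pose k : {nonneg R} := NngNum k0.
(* with C fixed, both sides are finite measures in E that agree on rectangles *)
pose m1 := image_measure (mrestr P mZC) (measurable_mfun_pair X Y).
pose m2 := mscale k (image_measure P (measurable_mfun_pair X Y)).
pose G : set (set (S1 * S2)) := [set A `*` B | A in measurable & B in measurable].
have -> : P (mfun_pair X Y @^-1` E `&` Z @^-1` C) = m1 E by [].
have m2E F : m2 F = (P (mfun_pair X Y @^-1` F) * P (Z @^-1` C))%E.
  by rewrite muleC -[X in (X * _)%E](fineK Pfin).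
rewrite -m2E.
apply: (@measure_unique _ R _ G (fun=> setT)) => //.
- exact: measurable_prod_measurableType.
- move=> _ _ [A mA [B mB <-]] [A' mA' [B' mB' <-]]; rewrite -setXI.
  by exists (A `&` A'); [exact: measurableI|exists (B `&` B') => //; exact: measurableI].
- by move=> _; exists setT => //; exists setT => //; rewrite setXTT.
- by rewrite bigcup_const//; exists 0%N.
- move=> _ [A mA [B mB <-]].
  transitivity (P (X @^-1` A `&` Y @^-1` B `&` Z @^-1` C)); first by [].
  by rewrite indep// m2E.
- move=> _; rewrite /m1 /image_measure /= /pushforward /mrestr.
  by rewrite preimage_setT setTI ltey_eq Pfin.
Qed.

Lemma mutually_independent3 d (T : measurableType d) (P : probability T R)
    (X : 'I_3 -> {RV P >-> R}) : mutually_independent X ->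
  forall A B C : set R, measurable A -> measurable B -> measurable C ->
    P (X 0 @^-1` A `&` X 1 @^-1` B `&` X 2 @^-1` C) =
    (P (X 0%R @^-1` A) * P (X 1%R @^-1` B) * P (X 2%R @^-1` C))%E.
Proof.
move=> indep A B C mA mB mC.
pose D (i : 'I_3) := if i == 0 then A else if i == 1 then B else C.
have mD i : measurable (D i) by rewrite /D; case: ifP => // _; case: ifP.
have := indep [set: 'I_3]%SET D mD.
rewrite big_mkcond/= !big_ord_recl big_ord0 !inE /D/= mule1.
have -> : lift ord0 ord0 = 1 :> 'I_3 by apply/val_inj.
have -> : lift ord0 (lift ord0 ord0) = 2 :> 'I_3 by apply/val_inj.
move=> /= e.
rewrite -muleA -[RHS]e; congr (P _).
apply/seteqP; split => w /=.
  move=> [[wA wB] wC] i _ /=.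
  by case: ifPn => [/eqP->//|i0]; case: ifPn => [/eqP->//|i1];
    have -> : i = 2 by apply/val_inj; case: i i0 i1 => -[|[|[|]]].
move=> h; have hD i : D i (X i w) by apply: (h i); rewrite /= inE.
by split; [split; [exact: (hD 0)|exact: (hD 1)]|exact: (hD 2)].
Qed.

End independence.

Section joint_law.
Context {R : realType}.
Local Notation N2 := (prodp (std_normal R) (std_normal R)).

(** Three independent Rayleigh variables have the joint law of the norms of
    three independent standard bivariate normals. *)
Lemma integral_rayleigh3 d (T : measurableType d) (P : probability T R)
    (X : 'I_3 -> {RV P >-> R}) :
  (forall i, is_rayleigh (X i)) -> mutually_independent X ->
  forall g : (R * R) * R -> \bar R,
  measurable_fun [set: (R * R) * R] g -> (forall z, 0 <= g z)%E ->
  (\int[P]_w g ((X 0%R w, X 1%R w), X 2%R w) =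
   \int[N2]_A \int[N2]_B \int[N2]_C g ((enorm2 A, enorm2 B), enorm2 C))%E.
Proof.
move=> rX iX g mg g0.
have i3 := mutually_independent3 iX.
have i01 A B : measurable A -> measurable B ->
    P (X 0 @^-1` A `&` X 1 @^-1` B) = (P (X 0%R @^-1` A) * P (X 1%R @^-1` B))%E.
  move=> mA mB; have := i3 A B setT mA mB measurableT.
  by rewrite preimage_setT setIT probability_setT mule1.
pose W : {mfun T >-> (R * R)%type} := mfun_pair (X 0) (X 1).
have iW E C : measurable E -> measurable C ->
    P (W @^-1` E `&` X 2 @^-1` C) = (P (W @^-1` E) * P (X 2%R @^-1` C))%E.
  move=> mE mC; apply: independent_pair_third => // A B D mA mB mD.
  by rewrite i3// i01.
have h := integral_independent_pair iW mg g0.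
transitivity (\int[distribution P W]_x \int[distribution P (X 2%R)]_y g (x, y))%E; first exact: h.
have mF := measurable_integral_snd (distribution P (X 2%R)) mg g0.
pose F z := (\int[distribution P (X 2%R)]_y g (z, y))%E.
have F0 z : (0 <= F z)%E by apply: integral_ge0 => y _; exact: g0.
have h1 := integral_distribution P W mF F0.
transitivity (\int[P]_w F (X 0%R w, X 1%R w))%E; first exact: h1.
have h2 := integral_independent_pair i01 mF F0.
transitivity (\int[distribution P (X 0%R)]_x \int[distribution P (X 1%R)]_y F (x, y))%E.
  exact: h2.
have mF1 := measurable_integral_snd (distribution P (X 1%R)) mF F0.
pose F1 x := (\int[distribution P (X 1%R)]_y F (x, y))%E.
have F10 z : (0 <= F1 z)%E by apply: integral_ge0 => y _; exact: F0.
have h3 := integral_rayleigh (rX 0) mF1 F10.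
transitivity (\int[N2]_A F1 (enorm2 A))%E; first exact: h3.
apply: eq_integral => A _.
have mF2 : measurable_fun [set: R] (fun y => F (enorm2 A, y)).
  by apply: (measurableT_comp mF); solve_measurable.
have h4 := integral_rayleigh (rX 1) mF2 (fun y => F0 _).
transitivity (\int[N2]_B F (enorm2 A, enorm2 B))%E; first exact: h4.
apply: eq_integral => B _.
have mF3 : measurable_fun [set: R] (fun y => g ((enorm2 A, enorm2 B), y)).
  by apply: (measurableT_comp mg); solve_measurable.
have h5 := integral_rayleigh (rX 2) mF3 (fun y => g0 _).
exact: h5.
Qed.

End joint_law.

Theorem corollary6p1 (R : realType) (d : measure_display)
  (T : measurableType d) (P : probability T R)
  (X : 'I_3 -> {RV P >-> R}) :
  (forall i, is_rayleigh (X i)) ->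
  mutually_independent X ->
  ('E_P[fun w => P_obt (X 0%R w) (X 1%R w) (X 2%R w)])%E = (3 / 4)%:E.
Proof.
move=> rX iX.
pose U := unif_angle R; pose U3 := prodp (prodp U U) U.
pose pt (r : (R * R) * R) (t : (R * R) * R) : ((R * R) * (R * R)) * (R * R) :=
  ((circle_point r.1.1 t.1.1, circle_point r.1.2 t.1.2), circle_point r.2 t.2).
pose f (z : ((R * R) * R) * ((R * R) * R)) := obtuse_indic (pt z.1 z.2).
have mf : measurable_fun [set: ((R * R) * R) * ((R * R) * R)] f.
  apply: (measurableT_comp measurable_obtuse_indic).
  by rewrite /pt /circle_point; solve_measurable_polar.
have f0 z : (0 <= f z)%E by exact: obtuse_indic_ge0.
pose g r := (\int[U3]_t f (r, t))%E.
have mg : measurable_fun [set: (R * R) * R] g by exact: (measurable_integral_snd U3 mf f0).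
have g0 r : (0 <= g r)%E by apply: integral_ge0 => t _; exact: f0.
have P_obtE r : (P_obt r.1.1 r.1.2 r.2)%:E = g r.
  rewrite /P_obt; set A := [set t | _].
  have fA t : f (r, t) = (\1_A t)%:E by rewrite /f obtuse_indicE !indicE.
  have mA : measurable A.
    have mfr : measurable_fun [set: (R * R) * R] (fun t => f (r, t)).
      by apply: (measurableT_comp mf); solve_measurable.
    have fE : (fun t => f (r, t)) = EFin \o \1_A by apply/funext => t; rewrite fA.
    rewrite fE in mfr; apply/measurable_indicP; apply/measurable_EFinP; exact: mfr.
  transitivity (U3 A).
    by rewrite -[RHS](fineK (fin_num_measure U3 A mA)).
  transitivity (\int[U3]_t (\1_A t)%:E)%E; first by rewrite integral_indic// setIT.
  by apply: eq_integral => t _; rewrite fA.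
rewrite unlock.
transitivity (\int[P]_w g ((X 0%R w, X 1%R w), X 2%R w))%E.
  by apply: eq_integral => w _; rewrite -P_obtE.
have h := integral_rayleigh3 rX iX mg g0.
have h2 := std_normal2_polar3 measurable_obtuse_indic (@obtuse_indic_ge0 R).
rewrite -(@std_normal2_obtuse R).
etransitivity; first exact: h.
exact: h2.
Qed.
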